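(* Let $m,n\ge4$ and $N=n+m-4$. Then $I_{C_N}=I_{P'_m}\times_{Q_{m,n}}I_{P_n}$, where the variable $z_S$ ($S$ a collider set of $C_N$) is identified with the variable $z_{(S\cap\{n,n+1,\dots,N,1\},\ S\cap\{2,\dots,n-1\})}$.
   Context: A DAG $\mathcal{G}$ on a vertex set $V$ has parent sets $\mathrm{pa}_{\mathcal{G}}(i)$; its characteristic imset assigns to $S\subseteq V$, $|S|\ge2$, the value $1$ if some $i\in S$ has $S\setminus\{i\}\subseteq\mathrm{pa}_{\mathcal{G}}(i)$, else $0$. A v-structure is $i\to k\leftarrow j$ with $i,j$ non-adjacent, and two DAGs are Markov equivalent iff they have the same skeleton and v-structures (equivalently the same characteristic imset). For an undirected graph $G$, $I_G$ is the kernel of the map sending a variable indexed by a Markov equivalence class with skeleton $G$ to $\prod_{S:c(S)=1}t_S$, where $c$ is the characteristic imset of any DAG in the class. $P_n$ is the path $1-2-\cdots-n$. Markov equivalence classes with skeleton $P_n$ are indexed by their collider sets $S\subseteq\{2,\dots,n-1\}$ containing no two consecutive integers (the set of $k$ with a v-structure $k-1\to k\leftarrow k+1$); $I_{P_n}\subseteq\mathbb{K}[y_S]$. $P'_m$ is the path with vertices $n-1,n,n+1,\dots,N,1,2$ in this order; its classes are indexed by sets $S'$ of interior vertices (from $n,\dots,N,1$) containing no two vertices consecutive along this path; $I_{P'_m}\subseteq\mathbb{K}[x_{S'}]$. $C_N$ is the cycle $1-2-\cdots-N-1$; its classes are indexed by nonempty $S\subseteq[N]$ with no two cyclically consecutive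 elements modulo $N$, and $I_{C_N}\subseteq\mathbb{K}[z_S]$. $Q_{m,n}$ is the set of pairs $(S',S)$ (collider sets of $P'_m$ and $P_n$) such that no two elements of $S'\cup S$ are cyclically consecutive modulo $N$, and $S'\cup S\neq\emptyset$. For $Q\subseteq R_1\times R_2$, $\phi_Q:\mathbb{K}[z_{(a,b)}:(a,b)\in Q]\to\mathbb{K}[x_a,y_b]$ is $z_{(a,b)}\mapsto x_ay_b$, and $I\times_QJ:=\phi_Q^{-1}(I+J)$. *)

(* Defs.v *)
From HB Require Import structures.
From mathcomp Require Import all_boot all_order all_algebra.
From mathcomp Require Import mpoly.

Set Implicit Arguments.
Unset Strict Implicit.
Unset Printing Implicit Defensive.

Import GRing.Theory.
Local Open Scope ring_scope.

Section DAGs.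
Variable V : finType.

(* A directed graph on V is given by its parent sets pa i. *)
Definition is_acyclic (pa : {ffun V -> {set V}}) : bool :=
  [exists f : {ffun V -> 'I_#|V|},
     [forall i, [forall j, (i \in pa j) ==> (f i < f j)%N]]].

Definition has_skeleton (adj : rel V) (pa : {ffun V -> {set V}}) : bool :=
  [forall i, [forall j, adj i j == ((i \in pa j) || (j \in pa i))]].

Definition collider_set (adj : rel V) (pa : {ffun V -> {set V}}) : {set V} :=
  [set k | [exists i, [exists j,
      [&& i != j, i \in pa k, j \in pa k & ~~ adj i j]]]].

Definition char_imset (pa : {ffun V -> {set V}}) (T : {set V}) : bool :=
  (1 < #|T|)%N && [exists i in T, (T :\ i) \subset pa i].

(* Characteristic imset of the Markov equivalence class with skeleton adj
   and collider set S: the characteristic imset of a DAG in that class. *)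
Definition class_imset (adj : rel V) (S : {set V}) (T : {set V}) : bool :=
  [exists pa : {ffun V -> {set V}},
     [&& is_acyclic pa, has_skeleton adj pa, collider_set adj pa == S
       & char_imset pa T]].
End DAGs.

Definition polyR (K : fieldType) (T : finType) := {mpoly K[#|T|]}.

Definition pvar (K : fieldType) (T : finType) (t : T) : polyR K T :=
  'X_(enum_rank t).

Definition ringmap (K : fieldType) (A B : finType) (h : A -> polyR K B)
    (p : polyR K A) : polyR K B :=
  mmap (@mpolyC _ K) (fun i => h (enum_val i)) p.

Definition toric_ideal (K : fieldType) (A V : finType)
    (c : A -> {set V} -> bool) (p : polyR K A) : bool :=
  ringmap (fun a => \prod_(T : {set V} | c a T) pvar K T) p == 0.

Definition ideal_gen (R : comNzRingType) (G : R -> Prop) (p : R) : Prop :=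
  exists s : seq (R * R),
    (forall x, x \in s -> G x.2) /\ p = \sum_(x <- s) x.1 * x.2.

(* Toric fiber product I x_Q J := phi_Q^{-1}(I + J), Q given by an
   (injective) labelling qv : Q -> A * B; phi_Q : z_q |-> x_a y_b. *)
Definition fiber_prod (K : fieldType) (A B Q : finType) (qv : Q -> A * B)
    (I : polyR K A -> bool) (J : polyR K B -> bool) (p : polyR K Q) : Prop :=
  ideal_gen
    (fun g : polyR K (A + B)%type =>
       (exists f, I f /\ g = ringmap (fun a => pvar K (inl a : (A + B)%type)) f)
    \/ (exists f, J f /\ g = ringmap (fun b => pvar K (inr b : (A + B)%type)) f))
    (ringmap (fun q => pvar K (inl (qv q).1 : (A + B)%type)
                       * pvar K (inr (qv q).2 : (A + B)%type)) p).

Definition path_adj (k : nat) : rel 'I_k :=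
  fun i j => (i.+1 == j :> nat) || (j.+1 == i :> nat).

(* Cycle C_N: position i is the vertex labelled i+1. *)
Definition cycle_adj (N : nat) : rel 'I_N :=
  fun i j => (i != j) && (((i.+1 %% N)%N == j :> nat) || ((j.+1 %% N)%N == i :> nat)).

Definition path_col (k : nat) (S : {set 'I_k}) : bool :=
  [forall i in S, (0 < i)%N && (i.+1 < k)%N]
  && [forall i in S, [forall j in S, i.+1 != j :> nat]].

Definition cycle_col (N : nat) (S : {set 'I_N}) : bool :=
  (S != set0) && [forall i in S, [forall j in S, (i.+1 %% N)%N != j :> nat]].

Definition PCol (k : nat) := {S : {set 'I_k} | path_col S}.
Definition CCol (N : nat) := {S : {set 'I_N} | cycle_col S}.

Definition I_path (K : fieldType) (k : nat) : polyR K (PCol k) -> bool :=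
  @toric_ideal K _ _ (fun S : PCol k => class_imset (@path_adj k) (val S)).
Definition I_cycle (K : fieldType) (N : nat) : polyR K (CCol N) -> bool :=
  @toric_ideal K _ _ (fun S : CCol N => class_imset (@cycle_adj N) (val S)).

(* P'_m: position j of P'_m (vertices n-1, n, ..., N, 1, 2) is the vertex of
   C_N at cycle position (n - 2 + j) mod N; position j of P_n is the vertex
   labelled j+1, i.e. cycle position j.  N = n + m - 4. *)
Definition unionQ (n m : nat) (S' : {set 'I_m}) (S : {set 'I_n})
    : {set 'I_(n + m - 4)} :=
  [set i : 'I_(n + m - 4) |
     [exists j in S', ((n - 2 + j) %% (n + m - 4))%N == i :> nat]
     || [exists j in S, j == i :> nat]].

Definition Qpred (n m : nat) (q : PCol m * PCol n) : bool :=
  cycle_col (@unionQ n m (val q.1) (val q.2)).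

Definition QType (n m : nat) := {q : PCol m * PCol n | @Qpred n m q}.

Definition kappa (n m : nat) (q : QType n m) : CCol (n + m - 4) :=
  exist _ (@unionQ n m (val (val q).1) (val (val q).2)) (valP q).

(* Main.v *)
Require Import Defs.
From HB Require Import structures.
From mathcomp Require Import all_boot all_order all_algebra.
From mathcomp Require Import mpoly zify ring.

(* A toric ideal is the kernel of a map X^m |-> X^(F m) on monomials, so p lies
   in it exactly when the coefficients of p sum to 0 over every fibre of F.
   Rewriting the x- and y-part of each monomial to a fixed representative of its
   fibre shows that I + J is the kernel of the joint map, so membership in
   I x_Q J is the same condition for the pair of exponent maps.  On a path, or on
   a cycle of length at least 4, the sets of imset value 1 are the edges and, for
   each collider k, the set {k-1, k, k+1}; hence the fibre of a monomial is
   determined by its degree and by how often each vertex occurs as a collider.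
   Every vertex of C_N is interior to exactly one of the two paths, so the two
   fibre partitions coincide. *)

Set Implicit Arguments.
Unset Strict Implicit.
Unset Printing Implicit Defensive.

Import GRing.Theory.

(** * Kernels of monomial maps *)

Section Balanced.
Local Open Scope ring_scope.
Variables (K : fieldType) (M U : eqType) (F : M -> U).

(** The kernel condition for the exponent map [F]. Values lie in any [eqType], since only the
    partition into fibres matters. *)
Definition balanced (s : seq M) (c : M -> K) : Prop :=
  forall m0, \sum_(m <- s | F m == F m0) c m = 0.

(** [Phi] is constant on each fibre of [F], so a fibre contributes one vector times a vanishing
    coefficient sum. The induction strips off the fibre of the head of [s]. *)
Lemma balanced_sum (W : lmodType K) (Phi : M -> W) (s : seq M) (c : M -> K) :
    (forall m m', F m = F m' -> Phi m = Phi m') ->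
  balanced s c -> \sum_(m <- s) c m *: Phi m = 0.
Proof.
move=> ePhi; have [k] := ubnP (size s).
elim: k s => // k IHk [|m0 s] size_s bal; first by rewrite big_nil.
rewrite (bigID (fun m => F m == F m0)) /=.
rewrite (eq_bigr (fun m => c m *: Phi m0)) => [|m /eqP/ePhi -> //].
rewrite -scaler_suml bal scale0r add0r -big_filter.
apply: IHk => [|m1].
  by rewrite /= eqxx /= size_filter (leq_ltn_trans (count_size _ _)).
rewrite big_filter_cond; have [e01|n01] := eqVneq (F m1) (F m0).
  by apply: big_pred0 => m; rewrite e01 andNb.
rewrite -[RHS](bal m1); apply: eq_bigl => m.
by case: (eqVneq (F m) (F m1)) => [->|]; rewrite ?n01 ?andbF.
Qed.

(** Monomials are linearly independent, and the coefficient at [X m0] is a sum of [c] over a fibre.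
    Hence [F] may be any invariant with the same fibres as [X]. *)
Lemma sum_balanced (n : nat) (X : M -> 'X_{1..n}) (s : seq M) (c : M -> K) :
    (forall m m', X m = X m' <-> F m = F m') ->
  \sum_(m <- s) c m *: 'X_[K, X m] = 0 <-> balanced s c.
Proof.
move=> eXF; split=> [sum0 m0|]; last first.
  by apply: balanced_sum => m m' /eXF ->.
have /(congr1 (mcoeff (X m0))) := sum0.
rewrite raddf_sum mcoeff0 /= => e0; rewrite -[RHS]e0 [LHS]big_mkcond.
apply: eq_bigr => m _.
rewrite mcoeffZ mcoeffX.
have ->: (F m == F m0) = (X m == X m0) by apply/eqP/eqP => /eXF.
by case: eqP; rewrite ?mulr1 ?mulr0.
Qed.
End Balanced.

(** * Monomial substitutions and their exponent maps *)

Section Ringmap.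
Local Open Scope ring_scope.
Variable K : fieldType.
Implicit Types A B C T : finType.

Lemma ringmapE A B (h : A -> polyR K B) (p : polyR K A) :
  ringmap h p =
    \sum_(m <- msupp p) p@_m *: \prod_a h a ^+ m (enum_rank a).
Proof.
rewrite /ringmap /mmap; apply: eq_bigr => m _; rewrite mul_mpolyC.
congr (_ *: _); rewrite /mmap1 (reindex (@enum_rank A)) /=.
  by apply: eq_bigr => a _; rewrite enum_rankK.
exact/onW_bij/enum_rank_bij.
Qed.

Lemma eq_ringmap A B (h g : A -> polyR K B) (p : polyR K A) :
  h =1 g -> ringmap h p = ringmap g p.
Proof.
move=> ehg; rewrite !ringmapE; apply: eq_bigr => m _; congr (_ *: _).
by apply: eq_bigr => a _; rewrite ehg.
Qed.

Lemma ringmapM A B (h : A -> polyR K B) : {morph ringmap h : p q / p * q}.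
Proof. exact: rmorphM. Qed.

Lemma ringmapX A B (h : A -> polyR K B) p k :
  ringmap h (p ^+ k) = ringmap h p ^+ k.
Proof. exact: rmorphXn. Qed.

Lemma ringmap_sum A B (h : A -> polyR K B) I (r : seq I) (P : pred I) E :
  ringmap h (\sum_(i <- r | P i) E i) = \sum_(i <- r | P i) ringmap h (E i).
Proof. exact: rmorph_sum. Qed.

Lemma ringmap_prod A B (h : A -> polyR K B) I (r : seq I) (P : pred I) E :
  ringmap h (\prod_(i <- r | P i) E i) = \prod_(i <- r | P i) ringmap h (E i).
Proof. exact: rmorph_prod. Qed.

Lemma ringmapB A B (h : A -> polyR K B) : {morph ringmap h : p q / p - q}.
Proof. exact: rmorphB. Qed.

Lemma ringmap0 A B (h : A -> polyR K B) : ringmap h 0 = 0.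
Proof. exact: rmorph0. Qed.

Lemma ringmapZ A B (h : A -> polyR K B) c p :
  ringmap h (c *: p) = c *: ringmap h p.
Proof. by rewrite -!mul_mpolyC ringmapM /ringmap mmapC. Qed.

Lemma ringmap_pvar A B (h : A -> polyR K B) a : ringmap h (pvar K a) = h a.
Proof. by rewrite /ringmap /pvar mmapX mmap1U enum_rankK. Qed.

Lemma ringmap_comp A B C (g : B -> polyR K C) (h : A -> polyR K B) p :
  ringmap g (ringmap h p) = ringmap (fun a => ringmap g (h a)) p.
Proof.
rewrite [ringmap h p]ringmapE ringmap_sum [RHS]ringmapE.
apply: eq_bigr => m _; rewrite ringmapZ ringmap_prod.
by congr (_ *: _); apply: eq_bigr => a _; rewrite ringmapX.
Qed.

(** The linear map on exponent vectors whose matrix has the columns [h a]. *)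
Definition expmap A B (h : A -> 'X_{1..#|B|}) (m : 'X_{1..#|A|}) : 'X_{1..#|B|} :=
  [multinom (\sum_a m (enum_rank a) * h a j)%N | j < #|B|].

Lemma prod_expmap A B (h : A -> 'X_{1..#|B|}) (m : 'X_{1..#|A|}) :
  \prod_a 'X_[h a] ^+ m (enum_rank a) = 'X_[K, expmap h m].
Proof.
under eq_bigr do rewrite mpolyXn.
rewrite -(big_morph _ (@mpolyXD _ K) (mpolyX0 _ K)); congr 'X_[_]; apply/mnmP => j.
rewrite mnm_sumE mnmE; apply: eq_bigr => a _.
by rewrite mulmnE mulnC.
Qed.

Lemma ringmap_mono A B (h : A -> 'X_{1..#|B|}) (p : polyR K A) :
  ringmap (fun a => 'X_[h a]) p = \sum_(m <- msupp p) p@_m *: 'X_[expmap h m].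
Proof.
by rewrite ringmapE; apply: eq_bigr => m _; rewrite prod_expmap.
Qed.

Lemma ringmap_monoX A B (h : A -> 'X_{1..#|B|}) m :
  ringmap (fun a => 'X_[h a]) 'X_[m] = 'X_[K, expmap h m].
Proof. by rewrite ringmap_mono msuppX big_seq1 mcoeffX eqxx scale1r. Qed.

Definition indic A T (c : A -> T -> bool) (a : A) : 'X_{1..#|T|} :=
  [multinom c a (enum_val j) : nat | j < #|T|].

Lemma prod_pvar A T (c : A -> T -> bool) a :
  \prod_(t | c a t) pvar K t = 'X_[indic c a].
Proof.
rewrite mpolyXE_id (reindex (@enum_rank T)) /=; last exact/onW_bij/enum_rank_bij.
rewrite big_mkcond; apply: eq_bigr => t _; rewrite mnmE enum_rankK.
by case: (c a t).
Qed.

(** Degree of the monomial in the variables with index in [P]; [predT] gives the total degree. *)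
Definition moncount A (m : 'X_{1..#|A|}) (P : pred A) : nat :=
  \sum_(a | P a) m (enum_rank a).

Lemma eq_moncount A (m : 'X_{1..#|A|}) (P Q : pred A) :
  P =1 Q -> moncount m P = moncount m Q.
Proof. exact: eq_bigl. Qed.

Lemma expmap_indicE A T (c : A -> T -> bool) m t :
  expmap (indic c) m (enum_rank t) = moncount m (fun a => c a t).
Proof.
rewrite mnmE /moncount [RHS]big_mkcond; apply: eq_bigr => a _.
by rewrite mnmE enum_rankK mulnbr.
Qed.

Lemma eq_expmap_indic A T (c : A -> T -> bool) m m' :
  expmap (indic c) m = expmap (indic c) m' <->
  forall t, moncount m (fun a => c a t) = moncount m' (fun a => c a t).
Proof.
split=> [e t|e]; first by rewrite -!expmap_indicE e.
by apply/mnmP => j; rewrite -[j]enum_valK !expmap_indicE.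
Qed.

Lemma toric_idealE A (V : finType) (c : A -> {set V} -> bool) (p : polyR K A) :
  toric_ideal c p = (ringmap (fun a => 'X_[indic c a]) p == 0).
Proof.
rewrite /toric_ideal; congr (_ == _); apply: eq_ringmap => a.
exact: prod_pvar.
Qed.

End Ringmap.

(** * Toric fiber products of toric ideals *)

Section FiberProduct.
Local Open Scope ring_scope.
Variables (K : fieldType) (A B Q V W : finType) (qv : Q -> A * B).
Variables (cA : A -> {set V} -> bool) (cB : B -> {set W} -> bool).

(** Exponents of the x-variables in the image of the monomial [m] under [phi]; [pushB] gives those
    of the y-variables. *)
Definition pushA (m : 'X_{1..#|Q|}) : 'X_{1..#|A|} :=
  expmap (indic (fun q a => a == (qv q).1)) m.
Definition pushB (m : 'X_{1..#|Q|}) : 'X_{1..#|B|} :=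
  expmap (indic (fun q b => b == (qv q).2)) m.

Definition fiber_deg (m : 'X_{1..#|Q|}) :=
  (expmap (indic cA) (pushA m), expmap (indic cB) (pushB m)).

Lemma moncount_pushA m P :
  moncount (pushA m) P = moncount m (fun q => P (qv q).1).
Proof.
rewrite /moncount [RHS](partition_big (fun q => (qv q).1) P) //=.
apply: eq_bigr => a Pa; rewrite expmap_indicE /moncount; apply: eq_bigl => q.
by rewrite (eq_sym a); case: eqP => [->|]; rewrite ?Pa ?andbF.
Qed.

Lemma moncount_pushB m P :
  moncount (pushB m) P = moncount m (fun q => P (qv q).2).
Proof.
rewrite /moncount [RHS](partition_big (fun q => (qv q).2) P) //=.
apply: eq_bigr => a Pa; rewrite expmap_indicE /moncount; apply: eq_bigl => q.
by rewrite (eq_sym a); case: eqP => [->|]; rewrite ?Pa ?andbF.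
Qed.

Lemma eq_fiber_deg m m' :
  fiber_deg m = fiber_deg m' <->
    (forall T, moncount m (fun q => cA (qv q).1 T)
               = moncount m' (fun q => cA (qv q).1 T))
 /\ (forall T, moncount m (fun q => cB (qv q).2 T)
               = moncount m' (fun q => cB (qv q).2 T)).
Proof.
split=> [e|[eA eB]].
  have /eq_expmap_indic eA := congr1 fst e.
  have /eq_expmap_indic eB := congr1 snd e.
  split=> T; first by move: (eA T); rewrite !moncount_pushA.
  by move: (eB T); rewrite !moncount_pushB.
congr pair; apply/eq_expmap_indic => T.
  by rewrite !moncount_pushA.
by rewrite !moncount_pushB.
Qed.

Let inA (f : polyR K A) : polyR K (A + B)%type :=
  ringmap (fun a => pvar K (inl a)) f.
Let inB (f : polyR K B) : polyR K (A + B)%type :=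
  ringmap (fun b => pvar K (inr b)) f.
Let phi (p : polyR K Q) : polyR K (A + B)%type :=
  ringmap (fun q => pvar K (inl (qv q).1) * pvar K (inr (qv q).2)) p.

Lemma phiE p :
  phi p = \sum_(m <- msupp p) p@_m *: (inA 'X_[pushA m] * inB 'X_[pushB m]).
Proof.
rewrite /phi ringmapE; apply: eq_bigr => m _; congr (_ *: _).
under eq_bigr do rewrite exprMn.
rewrite big_split; congr (_ * _); rewrite -prod_expmap /inA /inB ringmap_prod.
  apply: eq_bigr => q _; rewrite ringmapX -prod_pvar ringmap_prod.
  by rewrite big_pred1_eq ringmap_pvar.
apply: eq_bigr => q _; rewrite ringmapX -prod_pvar ringmap_prod.
by rewrite big_pred1_eq ringmap_pvar.
Qed.

(** A block-diagonal exponent matrix: x- and y-variables go to disjoint sets of parameters, so [psi]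
    performs both toric maps at once. *)
Let cAB (s : A + B) (t : {set V} + {set W}) : bool :=
  match s, t with
  | inl a, inl T => cA a T
  | inr b, inr T => cB b T
  | _, _ => false
  end.

Let psi : polyR K (A + B)%type -> polyR K ({set V} + {set W})%type :=
  ringmap (fun s => 'X_[indic cAB s]).

Lemma psi_inA f : toric_ideal cA f -> psi (inA f) = 0.
Proof.
move=> /eqP tf.
have -> : psi (inA f) = ringmap (fun T => pvar K (inl T))
   (ringmap (fun a => \prod_(T : {set V} | cA a T) pvar K T) f).
  rewrite /psi /inA !ringmap_comp; apply: eq_ringmap => a.
  rewrite ringmap_pvar -prod_pvar ringmap_prod big_sumType /= [X in _ * X]big_pred0 //.
  by rewrite mulr1; apply: eq_bigr => T _; rewrite ringmap_pvar.
by rewrite tf ringmap0.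
Qed.

Lemma psi_inB f : toric_ideal cB f -> psi (inB f) = 0.
Proof.
move=> /eqP tf.
have -> : psi (inB f) = ringmap (fun T => pvar K (inr T))
   (ringmap (fun a => \prod_(T : {set W} | cB a T) pvar K T) f).
  rewrite /psi /inB !ringmap_comp; apply: eq_ringmap => a.
  rewrite ringmap_pvar -prod_pvar ringmap_prod big_sumType /= [X in X * _]big_pred0 //.
  by rewrite mul1r; apply: eq_bigr => T _; rewrite ringmap_pvar.
by rewrite tf ringmap0.
Qed.

(** [psi] after [phi] is again a monomial substitution, and its exponent vector is the two
    components of [fiber_deg] side by side. *)
Lemma psi_phi (p : polyR K Q) :
  psi (phi p) = 0 ->
  balanced (K := K) fiber_deg (msupp p) (fun m => p@_m).
Proof.
rewrite /psi /phi ringmap_comp.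
pose h q := (indic cAB (inl (qv q).1) + indic cAB (inr (qv q).2))%MM.
rewrite (@eq_ringmap _ _ _ _ (fun q => 'X_[h q])) => [|q]; last first.
  by rewrite ringmapM !ringmap_pvar mpolyXD.
rewrite ringmap_mono => /sum_balanced; apply=> m m'.
have hE m1 t : expmap h m1 (enum_rank t) = moncount m1 (fun q =>
    match t with inl T => cA (qv q).1 T | inr T => cB (qv q).2 T end).
  rewrite mnmE /moncount [RHS]big_mkcond; apply: eq_bigr => q _.
  by rewrite mnmDE !mnmE enum_rankK; case: t => T /=; rewrite ?addn0 ?add0n mulnbr.
split=> [e|/eq_fiber_deg[eA eB]].
  apply/eq_fiber_deg; split=> T.
    by have := hE m (inl T); rewrite e hE.
  by have := hE m (inr T); rewrite e hE.
apply/mnmP => j; rewrite -[j]enum_valK !hE.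
by case: (enum_val j).
Qed.

(** [psi] kills both kinds of generators, which gives the forward direction. Conversely, let u', v'
    be representatives of the fibres of u, v: then x^u y^v - x^u' y^v' = y^v (x^u - x^u') + x^u'
    (y^v - y^v') lies in I + J, and the terms in x^u' y^v' cancel by balance. *)
Lemma fiber_prodP (p : polyR K Q) :
  fiber_prod qv (toric_ideal cA) (toric_ideal cB) p <->
  balanced (K := K) fiber_deg (msupp p) (fun m => p@_m).
Proof.
split=> [[s [gen_s phi_s]]|bal].
  apply: psi_phi; rewrite /phi phi_s [psi _]ringmap_sum big_seq big1 // => x.
  move=> /gen_s; rewrite ringmapM => -[] [f [If ->]].
    by rewrite [X in _ * X]psi_inA ?mulr0.
  by rewrite [X in _ * X]psi_inB ?mulr0.
(* [choose] returns the same element from every starting point in a fibre, hence a canonical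
   representative. *)
pose rep n k (F : 'X_{1..n} -> 'X_{1..k}) x := choose (fun y => F y == F x) x.
have repP n k F x : F (@rep n k F x) = F x.
  by apply/eqP/(@chooseP _ (fun y => F y == F x)).
have eq_rep n k F x y : F x = F y -> @rep n k F x = rep n k F y.
  move=> eF; rewrite /rep -eF (eq_choose (Q := fun z => F z == F y)) ?eF //.
  by apply: choose_id; rewrite ?eF.
pose rA := rep _ _ (expmap (indic cA)); pose rB := rep _ _ (expmap (indic cB)).
pose s := [seq (p@_m *: inB 'X_[pushB m],
                inA ('X_[pushA m] - 'X_[rA (pushA m)])) | m <- msupp p] ++
          [seq (p@_m *: inA 'X_[rA (pushA m)],
                inB ('X_[pushB m] - 'X_[rB (pushB m)])) | m <- msupp p].
exists s; split=> [x|].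
  have dif (C X : finType) (c : C -> {set X} -> bool) m :
      toric_ideal c ('X_[m] - 'X_[K, rep _ _ (expmap (indic c)) m]).
    by rewrite toric_idealE ringmapB !ringmap_monoX repP subrr.
  rewrite mem_cat => /orP[] /mapP[m _ ->] /=; [left|right].
    by exists ('X_[pushA m] - 'X_[rA (pushA m)]).
  by exists ('X_[pushB m] - 'X_[rB (pushB m)]).
rewrite big_cat [X in _ = X + _]big_map [X in _ = _ + X]big_map /=.
rewrite -[LHS]/(phi p) phiE -big_split /=.
apply/eqP; rewrite -subr_eq0 -sumrB; apply/eqP.
(* The part carried by representatives; its weighted sum is 0 by [bal], so it can stand for the
   right-hand side. *)
pose Phi m := inA 'X_[rA (pushA m)] * inB 'X_[rB (pushB m)].
rewrite -[RHS](balanced_sum (Phi := Phi) _ bal) => [|m m' e]; last first.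
  have [eA eB] := (congr1 fst e, congr1 snd e).
  by rewrite /Phi /rA /rB (eq_rep _ _ _ _ _ eA) (eq_rep _ _ _ _ _ eB).
apply: eq_bigr => m _; rewrite /inA /inB !ringmapB -/(inA _) -/(inB _) -!scalerAl.
rewrite -scalerDr -scalerBr; congr (_ *: _).
rewrite /Phi /inA /inB; ring.
Qed.

End FiberProduct.

(** * Characteristic imsets of graphs of degree at most 2 *)

Section ClassImset.
Variables (V : finType) (adj : rel V).
Hypothesis adj_irr : irreflexive adj.
Hypothesis adj_sym : ssrbool.symmetric adj.
Hypothesis adj_trifree : forall i a b, adj i a -> adj i b -> ~~ adj a b.
Hypothesis adj_deg2 : forall i a b c,
  adj i a -> adj i b -> adj i c -> a != b -> (c == a) || (c == b).

(** [class_imset] is false everywhere if no DAG realises [S], so realisability must be known before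
    its values are computed. *)
Definition has_class (S : {set V}) : Prop :=
  exists pa, [/\ is_acyclic pa, has_skeleton adj pa & collider_set adj pa = S].

Definition star (k : V) : {set V} := k |: [set j | adj k j].

(* Orient every edge towards its end of larger height; the colliders are then
   the vertices with two lower neighbours. *)
Lemma has_class_of_height (g : V -> nat) (S : {set V}) :
    (forall i j, adj i j -> g i != g j) ->
    (forall k, reflect (exists i j,
       [/\ i != j, adj k i, adj k j, g i < g k & g j < g k]) (k \in S)) ->
  has_class S.
Proof.
move=> g_adj SP.
pose pa := [ffun k => [set j | adj k j && (g j < g k)]].
have paE i k : (i \in pa k) = adj k i && (g i < g k) by rewrite ffunE inE.
exists pa; split.
(* Heights may exceed [#|V|]; acyclicity is witnessed by the rank of a vertex, the number of
   vertices strictly below it. *)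
- have rank_lt i : #|[set j | g j < g i]| < #|V|.
    rewrite -cardsT; apply/proper_card/properP; split; first exact: subsetT.
    by exists i; rewrite !inE ?ltnn.
  apply/existsP; exists [ffun i => Ordinal (rank_lt i)].
  apply/'forall_forallP => i j; apply/implyP; rewrite paE !ffunE /= => /andP[_ ij].
  apply/proper_card/properP; split.
    by apply/subsetP => x; rewrite !inE => /ltn_trans; apply.
  by exists i; rewrite !inE ?ltnn.
- apply/'forall_forallP => i j; rewrite !paE (adj_sym j i) -andb_orr.
  case: (boolP (adj i j)) => //= /g_adj; rewrite neq_ltn orbC => ->.
  by rewrite eqxx.
- apply/setP => k; rewrite inE; apply/'exists_existsP/SP => -[i [j]].
    rewrite !paE => /and4P[ij /andP[ki gi] /andP[kj gj] _].
    by exists i, j.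
  case=> ij ki kj gi gj; exists i, j.
  by rewrite !paE ij ki kj gi gj (adj_trifree ki kj).
Qed.

Lemma collider_nbrs S k : has_class S -> k \in S ->
  exists i j, [/\ i != j, adj k i & adj k j].
Proof.
move=> [pa [_ /'forall_forallP skel <-]].
rewrite inE => /'exists_existsP[i [j /and4P[ij ik jk _]]].
by exists i, j; rewrite (eqP (skel k i)) (eqP (skel k j)) ik jk !orbT.
Qed.

Lemma nbrs_eq k a b : a != b -> adj k a -> adj k b ->
  [set j | adj k j] = [set a; b].
Proof.
move=> ab ka kb; apply/setP => c; rewrite !inE.
by apply/idP/orP => [kc|[]/eqP-> //]; apply/orP; exact: (adj_deg2 ka kb).
Qed.

(** A set of value 1 is a vertex i with a nonempty set of its parents, at most two by the degree
    bound. One parent gives an edge. Two parents are non-adjacent for lack of triangles, so i is a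
    collider and the set is its star. *)
Lemma class_imsetP S T : has_class S ->
  reflect ((exists i j, adj i j /\ T = [set i; j])
           \/ exists2 k, k \in S & T = star k)
          (class_imset adj S T).
Proof.
move=> cS; apply: (iffP existsP) => [[pa /and4P[_]]|].
  move=> /'forall_forallP skel /eqP <- /andP[T1 /exists_inP[i iT sTi]].
  have nbr j : j \in pa i -> adj i j by move=> ji; rewrite (eqP (skel i j)) ji orbT.
  have [a /setD1P[ai aT]] : exists a, a \in T :\ i.
    apply/set0Pn; rewrite -card_gt0; move: T1; rewrite (cardsD1 i) iT; lia.
  have pai : a \in pa i by rewrite (subsetP sTi) // !inE ai.
  have [T2|] := eqVneq T [set i; a]; first by left; exists i, a; rewrite nbr.
  rewrite eq_sym eqEsubset subUset !sub1set iT aT /=.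
  case/subsetPn => b bT; rewrite !inE negb_or => /andP[bi ba].
  have pbi : b \in pa i by rewrite (subsetP sTi) // !inE bi.
  right; exists i.
    rewrite inE; apply/'exists_existsP; exists a, b.
    by rewrite eq_sym ba pai pbi (adj_trifree (nbr _ pai) (nbr _ pbi)).
  rewrite /star (nbrs_eq _ (nbr _ pai) (nbr _ pbi)) 1?eq_sym //.
  apply/eqP; rewrite eqEsubset !subUset !sub1set iT aT bT !andbT.
  apply/subsetP => c cT; have [->|ci] := eqVneq c i; first by rewrite !inE eqxx.
  have := adj_deg2 (nbr _ pai) (nbr _ pbi) (nbr c _).
  by rewrite !inE (negPf ci) eq_sym ba => -> //; rewrite (subsetP sTi) // !inE ci.
case: cS => pa [acyc skel cpa] edge; exists pa; rewrite acyc skel cpa eqxx /=.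
move/'forall_forallP: skel => skel.
case: edge => [[i [j [ij ->]]]|[k]].
  have nij : i != j by apply: contraTneq ij => ->; rewrite adj_irr.
  rewrite /char_imset cards2 nij /=; apply/exists_inP.
  move: (ij); rewrite (eqP (skel i j)) => /orP[pij|pji].
    exists j; first by rewrite !inE eqxx orbT.
    by apply/subsetP => x; rewrite !inE => /andP[/negPf->]; rewrite orbF => /eqP->.
  exists i; first by rewrite !inE eqxx.
  by apply/subsetP => x; rewrite !inE => /andP[/negPf->] /= /eqP->.
rewrite -cpa inE => /'exists_existsP[a [b /and4P[ab ak bk _]]] ->.
have ka : adj k a by rewrite (eqP (skel k a)) ak orbT.
have kb : adj k b by rewrite (eqP (skel k b)) bk orbT.
have nka : k != a by apply: contraTneq ka => ->; rewrite adj_irr.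
rewrite /star (nbrs_eq ab ka kb); apply/andP; split.
  apply: leq_trans (_ : #|[set k; a]| <= _); first by rewrite cards2 nka.
  by apply/subset_leq_card; rewrite setUA subsetUl.
apply/exists_inP; exists k; first by rewrite !inE eqxx.
apply/subsetP => x; rewrite !inE => /andP[/negPf->] /=.
by case/orP => /eqP->.
Qed.

(** If k and k' differ they are adjacent, and any further neighbour of k' lies in [star k], closing
    a triangle. Then k would be the only neighbour of k'. *)
Lemma star_inj k k' i j : i != j -> adj k' i -> adj k' j ->
  star k = star k' -> k = k'.
Proof.
move=> ij ki kj e; apply/eqP; apply/negPn/negP => nkk.
have : k \in star k' by rewrite -e !inE eqxx.
rewrite !inE (negPf nkk) /= => kk.
have sub x : adj k' x -> x = k.
  move=> kx; apply/eqP; apply/negPn/negP => xk.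
  have : x \in star k by rewrite e !inE kx orbT.
  rewrite !inE (negPf xk) /=; apply/negP/(adj_trifree kk kx).
by move: ij; rewrite (sub i) // (sub j) // eqxx.
Qed.


(** The star has three elements, so it is no edge, and by [star_inj] it is the star of no other
    collider. *)
Lemma class_imset_star S k i j : i != j -> adj k i -> adj k j -> has_class S ->
  class_imset adj S (star k) = (k \in S).
Proof.
move=> ij ki kj cS; apply/class_imsetP/idP => //; last by right; exists k.
case=> [[u [v [uv e]]]|[k' k'S e]]; last first.
  by have [a [b [ab ka kb]]] := collider_nbrs cS k'S; rewrite (star_inj ab ka kb e).
have nk x : adj k x -> k != x by apply: contraTneq => <-; rewrite adj_irr.
move/(congr1 (fun X : {set V} => #|X|)): e.
rewrite /star (nbrs_eq ij ki kj) cardsU1 !cards2 ij !inE negb_or !nk //=.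
by case: (u != v).
Qed.

Lemma class_imset_edge S i j : adj i j -> has_class S ->
  class_imset adj S [set i; j].
Proof. by move=> ij cS; apply/class_imsetP => //; left; exists i, j. Qed.

(** Every class gives an edge the value 1, so an edge records the degree; stars record the collider
    counts; any other set counts 0. *)
Lemma eq_class_imset_counts (A : finType) (col : A -> {set V})
    (m m' : 'X_{1..#|A|}) :
    (forall a, has_class (col a)) -> (exists i j, adj i j) ->
  (forall T, moncount m (fun a => class_imset adj (col a) T) =
             moncount m' (fun a => class_imset adj (col a) T)) <->
  (moncount m predT = moncount m' predT /\
   forall k, moncount m (fun a => k \in col a) = moncount m' (fun a => k \in col a)).
Proof.
move=> cc [i0 [j0 ij0]].
have edgeT i j : adj i j ->
    (fun a => class_imset adj (col a) [set i; j]) =1 predT.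
  by move=> ij a; rewrite class_imset_edge.
have starT k i j : i != j -> adj k i -> adj k j ->
    (fun a => class_imset adj (col a) (star k)) =1 (fun a => k \in col a).
  by move=> ij ki kj a; rewrite (class_imset_star ij).
split=> [eT|[e1 ek] T].
  split=> [|k].
    by have := eT [set i0; j0]; rewrite !(eq_moncount _ (edgeT _ _ ij0)).
  (* A vertex that is a collider in some class has two neighbours, so its star detects it; for any
     other vertex both counts are 0. *)
  have [/existsP[a ka]|/existsPn nk] := boolP [exists a, k \in col a].
    have [i [j [ij ki kj]]] := collider_nbrs (cc a) ka.
    by have := eT (star k); rewrite !(eq_moncount _ (starT _ _ _ ij ki kj)).
  by rewrite /moncount !big_pred0 // => a; apply: negPf.
have [/'exists_existsP[i [j /andP[ij /eqP ->]]]|nedge] :=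
    boolP [exists i, exists j, adj i j && (T == [set i; j])].
  by rewrite !(eq_moncount _ (edgeT _ _ ij)).
have [/'exists_existsP[a [k /andP[ka /eqP ->]]]|nstar] :=
    boolP [exists a, exists k, (k \in col a) && (T == star k)].
  have [i [j [ij ki kj]]] := collider_nbrs (cc a) ka.
  by rewrite !(eq_moncount _ (starT _ _ _ ij ki kj)).
have no_class a : class_imset adj (col a) T = false.
  case: (class_imsetP T (cc a)) => // -[[i [j [ij eT]]]|[k ka eT]].
    by case/'exists_existsP: nedge; exists i, j; rewrite ij eT eqxx.
  by case/'exists_existsP: nstar; exists a, k; rewrite ka eT eqxx.
by rewrite /moncount !big_pred0.
Qed.

End ClassImset.

(** * Paths and cycles *)

Section Path.
Variable k : nat.
Local Notation adj := (@path_adj k).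

Lemma path_irr : irreflexive adj.
Proof. by move=> i; rewrite /path_adj; lia. Qed.

Lemma path_sym : ssrbool.symmetric adj.
Proof. by move=> i j; rewrite /path_adj orbC. Qed.

Lemma path_trifree i a b : adj i a -> adj i b -> ~~ adj a b.
Proof. by rewrite /path_adj; lia. Qed.

Lemma path_deg2 i a b c :
  adj i a -> adj i b -> adj i c -> a != b -> (c == a) || (c == b).
Proof. by rewrite /path_adj -!val_eqE /=; lia. Qed.

Lemma path_colP (S : {set 'I_k}) : path_col S ->
  (forall i, i \in S -> 0 < i /\ i.+1 < k) /\
  (forall i j, i \in S -> j \in S -> i.+1 != j :> nat).
Proof.
case/andP=> /forall_inP inter /forall_inP cons; split=> [i /inter/andP //|i j iS jS].
by have /forall_inP := cons i iS; apply.
Qed.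

Lemma path_has_class (S : {set 'I_k}) : path_col S -> has_class adj S.
Proof.
move=> /path_colP[inter cons].
(* This height orients the edge {j, j+1} upwards exactly when j is not in S. *)
apply: (has_class_of_height path_sym path_trifree
          (g := fun j => 2 * j + 3 * (j \in S))).
  move=> i j ij; have := cons i j; have := cons j i; move: ij.
  rewrite /path_adj; case: (i \in S); case: (j \in S) => /=; lia.
move=> x; apply: (iffP idP) => [xS|[i [j [ij]]]].
  have [x0 xk] := inter x xS.
  have pk : x.-1 < k by lia.
  exists (Ordinal pk), (Ordinal xk); rewrite /path_adj -val_eqE /= xS.
  have /negPf -> : Ordinal pk \notin S.
    by apply/negP => /cons /(_ xS) /=; lia.
  have /negPf -> : Ordinal xk \notin S.
    by apply/negP => /(cons _ _ xS) /=; lia.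
  split; lia.
rewrite /path_adj; move: ij; rewrite -val_eqE /=.
by case: (x \in S) => //=; case: (i \in S); case: (j \in S) => /=; lia.
Qed.

End Path.

Section Cycle.
Variable N : nat.
Hypothesis N_ge4 : 4 <= N.
Local Notation adj := (@cycle_adj N).

Lemma succ_modE (i : 'I_N) : i.+1 %% N = if i.+1 == N then 0 else i.+1.
Proof.
have := ltn_ord i; case: eqP => [->|ne lt]; first by rewrite modnn.
by rewrite modn_small //; lia.
Qed.

(** Listing the wrap-around edge in both directions removes the modulus and turns adjacency into
    linear arithmetic. *)
Lemma cycle_adjE i j : adj i j =
  [|| i.+1 == j :> nat, j.+1 == i :> nat, (i == 0 :> nat) && (j.+1 == N)
    | (j == 0 :> nat) && (i.+1 == N)].
Proof.
rewrite /cycle_adj !succ_modE -val_eqE /=.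
have := ltn_ord i; have := ltn_ord j.
by do 2!case: ifP; lia.
Qed.

Lemma cycle_irr : irreflexive adj.
Proof. by move=> i; rewrite cycle_adjE; lia. Qed.

Lemma cycle_sym : ssrbool.symmetric adj.
Proof. by move=> i j; rewrite !cycle_adjE; lia. Qed.

(** The bound [4 <= N] excludes the triangle. *)
Lemma cycle_trifree i a b : adj i a -> adj i b -> ~~ adj a b.
Proof.
have := ltn_ord i; have := ltn_ord a; have := ltn_ord b.
by rewrite !cycle_adjE; lia.
Qed.

Lemma cycle_deg2 i a b c :
  adj i a -> adj i b -> adj i c -> a != b -> (c == a) || (c == b).
Proof.
have := ltn_ord i; have := ltn_ord a; have := ltn_ord b; have := ltn_ord c.
by rewrite !cycle_adjE -!val_eqE /=; lia.
Qed.

Lemma cycle_colP (S : {set 'I_N}) : cycle_col S ->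
  forall i j, i \in S -> j \in S -> ~~ adj i j.
Proof.
case/andP=> _ /forall_inP cons i j iS jS; apply/negP => /andP[_ /orP[] /eqP e].
  by have /forall_inP/(_ j jS)/eqP := cons i iS.
by have /forall_inP/(_ i iS)/eqP := cons j jS.
Qed.

Lemma cycle_has_class (S : {set 'I_N}) : cycle_col S -> has_class adj S.
Proof.
move=> cS; have /andP[/set0Pn[s sS] _] := cS; have cons := cycle_colP cS.
(* Numbering the vertices from the one following a collider s, the path height
   also orients the closing edge towards s. *)
pose d (j : 'I_N) := if s < j then j - s.+1 else j + N - s.+1.
have nb i j : adj i j -> (i \in S) && (j \in S) = false.
  by move=> ij; apply/andP => -[iS jS]; have := cons i j iS jS; rewrite ij.
(* The branches of [d] as linear constraints: [s] gets the maximum [N - 1] and its cyclic successor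
   gets 0. *)
have dP (j : 'I_N) :
    [|| (d j == j - s.+1) && (s < j) | (d j == j + N - s.+1) && (j <= s)].
  by rewrite /d; case: (ltnP s j); rewrite eqxx //= orbT.
have sE (j : 'I_N) : (j == s :> nat) -> j \in S by move/eqP/val_inj ->.
apply: (has_class_of_height cycle_sym cycle_trifree
          (g := fun j => 2 * d j + 3 * (j \in S))).
  move=> i j ij; have := nb i j ij; move: ij; rewrite cycle_adjE.
  have := sE i; have := sE j; have := dP i; have := dP j.
  have := ltn_ord i; have := ltn_ord j; have := ltn_ord s.
  case: (i \in S); case: (j \in S) => //=; lia.
move=> x; apply: (iffP idP) => [xS|[i [j [ij]]]].
  have xN := ltn_ord x.
  (* [p] and [t] are the cyclic predecessor and successor of [x]; as neighbours of a collider they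
     are not colliders. *)
  have [p pE] : exists p : 'I_N, (x == 0 :> nat) && (p.+1 == N) || (p.+1 == x).
    have pN : (if x == 0 :> nat then N.-1 else x.-1) < N by case: ifP; lia.
    by exists (Ordinal pN); rewrite /=; case: ifP; lia.
  have [t tE] : exists t : 'I_N, (t == 0 :> nat) && (x.+1 == N) || (x.+1 == t).
    have tN : (if x.+1 == N then 0 else x.+1) < N by case: ifP; lia.
    by exists (Ordinal tN); rewrite /=; case: ifP; lia.
  have xp : adj x p by rewrite cycle_adjE; lia.
  have xt : adj x t by rewrite cycle_adjE; lia.
  have := nb _ _ xp; have := nb _ _ xt; rewrite xS /= => tS pS.
  have := sE p; have := sE t; rewrite pS tS => ts ps.
  have dx := dP x; have dp := dP p; have dt := dP t.
  have sN := ltn_ord s.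
  exists p, t; split=> //; rewrite ?xS ?pS ?tS -?val_eqE /=; lia.
rewrite !cycle_adjE; move: ij; rewrite -val_eqE /=.
have := sE i; have := sE j; have := dP i; have := dP j; have := dP x; have := sE x.
have := ltn_ord i; have := ltn_ord j; have := ltn_ord s; have := ltn_ord x.
by case: (x \in S) => //=; case: (i \in S); case: (j \in S) => /=; lia.
Qed.

End Cycle.

(** * Cutting the cycle into two paths *)

Section Gluing.
Variables m n : nat.
Hypotheses (hm : 4 <= m) (hn : 4 <= n).
Local Notation N := (n + m - 4).

(** Only the last two positions of the left path wrap around, to cycle positions 0 and 1. *)
Lemma pos_modE j : j < m ->
  (n - 2 + j) %% N = if j + 2 < m then n - 2 + j else j + 2 - m.
Proof.
move=> jm; case: ifP => jm2; first by rewrite modn_small //; lia.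
have -> : n - 2 + j = (j + 2 - m) + N by lia.
by rewrite modnDr modn_small //; lia.
Qed.

Lemma mem_unionQ (S' : {set 'I_m}) (S : {set 'I_n}) (i : 'I_N) :
  reflect ((exists2 j, j \in S' & (n - 2 + j) %% N = i)
           \/ (exists2 j, j \in S & j = i :> nat))
          (i \in unionQ S' S).
Proof.
rewrite inE; apply: (iffP orP) => -[].
- by case/exists_inP=> j jS /eqP e; left; exists j.
- by case/exists_inP=> j jS /eqP e; right; exists j.
- by case=> j jS e; left; apply/exists_inP; exists j => //; apply/eqP.
- by case=> j jS e; right; apply/exists_inP; exists j => //; apply/eqP.
Qed.

(** Interior positions of the left path land on cycle positions n-1, ..., N-1, 0, whereas [S] only
    reaches 1, ..., n-2. *)
Lemma mem_unionQ_left S' S (i : 'I_N) (j : 'I_m) : path_col S' -> path_col S ->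
  0 < j -> j.+1 < m -> i = (n - 2 + j) %% N :> nat ->
  (i \in @unionQ n m S' S) = (j \in S').
Proof.
move=> /path_colP[inter' _] /path_colP[inter _] j0 jm ij.
apply/mem_unionQ/idP => [[] [x xS]|jS]; last by left; exists j.
  have := inter' x xS; rewrite ij !pos_modE ?ltn_ord // => -[x0 xm] e.
  suff -> : j = x by [].
  by apply/val_inj => /=; move: e; do 2!case: ifP; lia.
have := inter x xS; rewrite ij !pos_modE ?ltn_ord // => -[x0 xm].
by case: ifP; lia.
Qed.

Lemma mem_unionQ_right S' S (i : 'I_N) (j : 'I_n) : path_col S' -> path_col S ->
  0 < j -> j.+1 < n -> i = j :> nat ->
  (i \in @unionQ n m S' S) = (j \in S).
Proof.
move=> /path_colP[inter' _] /path_colP[inter _] j0 jm ij.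
apply/mem_unionQ/idP => [[] [x xS]|jS]; last by right; exists j.
  have := inter' x xS; rewrite ij !pos_modE ?ltn_ord // => -[x0 xm].
  by case: ifP; lia.
by rewrite ij => /val_inj <-.
Qed.

Variant interior_spec (i : nat) : Prop :=
  | LeftInterior (j : 'I_m) of 0 < j & j.+1 < m & i = (n - 2 + j) %% N
  | RightInterior (j : 'I_n) of 0 < j & j.+1 < n & i = j.

(** The paths share the vertices 1, 2, n-1 and n, each of which is an end of exactly one of them. *)
Lemma interiorP (i : 'I_N) : interior_spec i.
Proof.
have iN := ltn_ord i.
have [i0|i0] := posnP i.
  (* Cycle position 0 is the last interior position of the left path. *)
  have jm : m - 2 < m by lia.
  by apply: (@LeftInterior _ (Ordinal jm)); rewrite ?pos_modE //=; try case: ifP; lia.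
have [ni|ni] := ltnP i.+1 n.
  have jn : i < n by lia.
  by apply: (@RightInterior _ (Ordinal jn)).
have jm : i - (n - 2) < m by lia.
by apply: (@LeftInterior _ (Ordinal jm)); rewrite ?pos_modE //=; try case: ifP; lia.
Qed.

(** [left_trace] and [right_trace] are the components of the inverse of [kappa]. *)
Definition left_trace (C : {set 'I_N}) : {set 'I_m} :=
  [set j : 'I_m | [&& 0 < j, j.+1 < m &
     [exists i in C, i == (n - 2 + j) %% N :> nat]]].
Definition right_trace (C : {set 'I_N}) : {set 'I_n} :=
  [set j : 'I_n | [&& 0 < j, j.+1 < n & [exists i in C, i == j :> nat]]].

Lemma pos_lt j : (n - 2 + j) %% N < N.
Proof. by rewrite ltn_mod; lia. Qed.

Lemma left_trace_unionQ S' S : path_col S' -> path_col S ->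
  left_trace (unionQ S' S) = S'.
Proof.
move=> c' c; apply/setP => j; rewrite inE; apply/and3P/idP => [[j0 jm]|jS].
  by case/exists_inP=> i iU /eqP e; rewrite -(mem_unionQ_left c' c j0 jm e).
have [inter' _] := path_colP c'; have [j0 jm] := inter' j jS.
split=> //; apply/exists_inP; exists (Ordinal (pos_lt j)) => //=.
by rewrite (mem_unionQ_left c' c j0 jm).
Qed.

Lemma right_trace_unionQ S' S : path_col S' -> path_col S ->
  right_trace (unionQ S' S) = S.
Proof.
move=> c' c; apply/setP => j; rewrite inE; apply/and3P/idP => [[j0 jm]|jS].
  by case/exists_inP=> i iU /eqP e; rewrite -(mem_unionQ_right c' c j0 jm e).
have [inter _] := path_colP c; have [j0 jn] := inter j jS.
have jN : j < N by lia.
split=> //; apply/exists_inP; exists (Ordinal jN) => //=.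
by rewrite (mem_unionQ_right c' c j0 jn).
Qed.

Lemma glued_length_ge4 : 4 <= N.
Proof. lia. Qed.

Lemma left_trace_path_col C : cycle_col C -> path_col (left_trace C).
Proof.
move/(cycle_colP) => cons; apply/andP; split.
  by apply/forall_inP => j; rewrite inE => /and3P[-> ->].
apply/forall_inP => j /[!inE] /and3P[j0 jm /exists_inP[i iC /eqP ij]].
apply/forall_inP => k /[!inE] /and3P[k0 km /exists_inP[l lC /eqP lk]].
apply/eqP => jk; have := cons i l iC lC; rewrite (cycle_adjE glued_length_ge4) ij lk.
by rewrite !pos_modE ?ltn_ord //; do 2!case: ifP; lia.
Qed.

Lemma right_trace_path_col C : cycle_col C -> path_col (right_trace C).
Proof.
move/(cycle_colP) => cons; apply/andP; split.
  by apply/forall_inP => j; rewrite inE => /and3P[-> ->].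
apply/forall_inP => j /[!inE] /and3P[j0 jm /exists_inP[i iC /eqP ij]].
apply/forall_inP => k /[!inE] /and3P[k0 km /exists_inP[l lC /eqP lk]].
by apply/eqP => jk; have := cons i l iC lC; rewrite (cycle_adjE glued_length_ge4); lia.
Qed.

Lemma unionQ_trace C : cycle_col C -> unionQ (left_trace C) (right_trace C) = C.
Proof.
move=> cC; have c' := left_trace_path_col cC; have c := right_trace_path_col cC.
apply/setP => i; case: (interiorP i) => j j0 jm e.
  rewrite (mem_unionQ_left c' c j0 jm e) inE j0 jm /=.
  apply/exists_inP/idP => [[l lC]|iC]; last by exists i => //; apply/eqP.
  by rewrite -e => /eqP/val_inj <-.
rewrite (mem_unionQ_right c' c j0 jm e) inE j0 jm /=.
apply/exists_inP/idP => [[l lC]|iC]; last by exists i => //; apply/eqP.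
by rewrite -e => /eqP/val_inj <-.
Qed.

Lemma kappa_trace (q : QType n m) :
  val (val q).1 = left_trace (val (kappa q)) /\
  val (val q).2 = right_trace (val (kappa q)).
Proof.
have [c' c] := (valP (val q).1, valP (val q).2).
by split; rewrite /kappa /= ?left_trace_unionQ ?right_trace_unionQ.
Qed.

(** The pair of traces is a preimage, and by [kappa_trace] a pair is recovered from its union. *)
Lemma kappa_bij : bijective (@kappa n m).
Proof.
have surj (C : CCol N) : exists q, kappa q == C.
  have cC := valP C.
  pose q1 : PCol m := exist _ (left_trace (val C)) (left_trace_path_col cC).
  pose q2 : PCol n := exist _ (right_trace (val C)) (right_trace_path_col cC).
  have Qq : Qpred (q1, q2) by rewrite /Qpred /= unionQ_trace.
  by exists (exist _ (q1, q2) Qq); rewrite -val_eqE /= unionQ_trace.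
exists (fun C => xchoose (surj C)) => [q|C]; last exact/eqP/(xchooseP (surj C)).
have /eqP e := xchooseP (surj (kappa q)).
have [e1 e2] := kappa_trace (xchoose (surj (kappa q))).
have [f1 f2] := kappa_trace q.
apply/val_inj/eqP; rewrite -pair_eqE /pair_eq -!val_eqE /=.
by rewrite e1 e2 f1 f2 e !eqxx.
Qed.

(** Each cycle vertex is interior to one path, so its collider count is the count at that path
    position. *)
Lemma eq_cycle_path_counts (mu mu' : 'X_{1..#|(QType n m : finType)|}) :
  (forall i, moncount mu (fun q => i \in val (kappa q)) =
             moncount mu' (fun q => i \in val (kappa q))) <->
  (forall j, moncount mu (fun q => j \in val (val q).1) =
             moncount mu' (fun q => j \in val (val q).1)) /\
  (forall j, moncount mu (fun q => j \in val (val q).2) =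
             moncount mu' (fun q => j \in val (val q).2)).
Proof.
have lE (q : QType n m) (i : 'I_N) (j : 'I_m) : 0 < j -> j.+1 < m ->
    i = (n - 2 + j) %% N :> nat -> (i \in val (kappa q)) = (j \in val (val q).1).
  exact: mem_unionQ_left (valP (val q).1) (valP (val q).2).
have rE (q : QType n m) (i : 'I_N) (j : 'I_n) : 0 < j -> j.+1 < n ->
    i = j :> nat -> (i \in val (kappa q)) = (j \in val (val q).2).
  exact: mem_unionQ_right (valP (val q).1) (valP (val q).2).
split=> [e|[e1 e2] i].
  split=> j.
    have [/andP[j0 jm]|nj] := boolP ((0 < j) && (j.+1 < m)).
      have jE q := lE q (Ordinal (pos_lt j)) j j0 jm erefl.
      by rewrite -!(eq_moncount _ jE).
    (* The ends of a path are never colliders, so both counts are 0 there. *)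
    have nS (q : QType n m) : (j \in val (val q).1) = false.
      by apply: contraNF nj; have [inter _] := path_colP (valP (val q).1) => /inter/andP.
    by rewrite /moncount !big_pred0.
  have [/andP[j0 jn]|nj] := boolP ((0 < j) && (j.+1 < n)).
    have jN : j < N by lia.
    have jE q := rE q (Ordinal jN) j j0 jn erefl.
    by rewrite -!(eq_moncount _ jE).
  have nS (q : QType n m) : (j \in val (val q).2) = false.
    by apply: contraNF nj; have [inter _] := path_colP (valP (val q).2) => /inter/andP.
  by rewrite /moncount !big_pred0.
case: (interiorP i) => j j0 jm ij.
  by rewrite !(eq_moncount _ (fun q => lE q i j j0 jm ij)).
by rewrite !(eq_moncount _ (fun q => rE q i j j0 jm ij)).
Qed.

End Gluing.

(** * Imset fibres of paths and cycles, and the comparison of ideals *)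

Lemma eq_path_imset_counts k (A : finType) (col : A -> {set 'I_k})
    (mu mu' : 'X_{1..#|A|}) : 2 <= k -> (forall a, path_col (col a)) ->
  (forall T, moncount mu (fun a => class_imset (@path_adj k) (col a) T) =
             moncount mu' (fun a => class_imset (@path_adj k) (col a) T)) <->
  (moncount mu predT = moncount mu' predT /\
   forall j, moncount mu (fun a => j \in col a) = moncount mu' (fun a => j \in col a)).
Proof.
move=> k2 cc; apply: eq_class_imset_counts.
- exact: path_irr.
- exact: path_trifree.
- exact: path_deg2.
- by move=> a; apply: path_has_class.
- have k0 : 0 < k by lia.
  by exists (Ordinal k0), (Ordinal k2).
Qed.

Lemma eq_cycle_imset_counts N (A : finType) (col : A -> {set 'I_N})
    (mu mu' : 'X_{1..#|A|}) : 4 <= N -> (forall a, cycle_col (col a)) ->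
  (forall T, moncount mu (fun a => class_imset (@cycle_adj N) (col a) T) =
             moncount mu' (fun a => class_imset (@cycle_adj N) (col a) T)) <->
  (moncount mu predT = moncount mu' predT /\
   forall j, moncount mu (fun a => j \in col a) = moncount mu' (fun a => j \in col a)).
Proof.
move=> N_ge4 cc; apply: eq_class_imset_counts.
- exact: cycle_irr.
- exact: cycle_trifree.
- exact: cycle_deg2.
- by move=> a; apply: cycle_has_class.
- have [N0 N1] : 0 < N /\ 1 < N by lia.
  by exists (Ordinal N0), (Ordinal N1); rewrite cycle_adjE.
Qed.

Theorem theorem5p1 (K : fieldType) (m n : nat) (hm : (4 <= m)%N) (hn : (4 <= n)%N) :
  (* the identification  S'  u  S  <->  (S', S)  is a bijection Q_{m,n} -> collider sets of C_N *)
  bijective (@kappa n m)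
  /\ (forall q : QType n m,
        (* S' = (S' u S) n {n,...,N,1},  read in the positions of P'_m *)
        val (val q).1 =
          [set j : 'I_m | [&& (0 < j)%N, (j.+1 < m)%N &
             [exists i in val (kappa q), (i == (n - 2 + j) %% (n + m - 4) :> nat)%N]]]
        (* S = (S' u S) n {2,...,n-1},  read in the positions of P_n *)
     /\ val (val q).2 =
          [set j : 'I_n | [&& (0 < j)%N, (j.+1 < n)%N &
             [exists i in val (kappa q), (i == j :> nat)%N]]])
  (* I_{C_N} = I_{P'_m} x_{Q_{m,n}} I_{P_n} under this identification *)
  /\ (forall p : polyR K (QType n m),
        fiber_prod (fun q : QType n m => ((val q).1, (val q).2))
                   (@I_path K m) (@I_path K n) p
        <-> @I_cycle K (n + m - 4) (ringmap (fun q => pvar K (kappa q)) p)).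
Proof.
split; first exact: kappa_bij.
split; first exact: kappa_trace.
move=> p; rewrite fiber_prodP.
rewrite /I_cycle toric_idealE ringmap_comp.
rewrite (@eq_ringmap _ _ _ _ (fun q => mpolyX _ (indic
   (fun q (T : {set 'I_(n + m - 4)}) => class_imset (@cycle_adj _) (val (kappa q)) T) q)));
   last first.
  by move=> q; rewrite ringmap_pvar.
rewrite ringmap_mono; apply: (iff_trans _ (rwP eqP)).
(* Both memberships are fibre-sum conditions on the same coefficients; it remains to match the
   fibres of the two exponent maps. *)
apply: iff_sym; apply: sum_balanced => mu mu'.
rewrite eq_expmap_indic eq_fiber_deg.
rewrite (eq_cycle_imset_counts _ _ (glued_length_ge4 hm hn)) => [|q];
  last exact: valP (kappa q).
rewrite (eq_path_imset_counts _ _ _ (fun q => valP (val q).1)); last by lia.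
rewrite (eq_path_imset_counts _ _ _ (fun q => valP (val q).2)); last by lia.
rewrite (eq_cycle_path_counts hm hn).
(* The total degree occurs once for the cycle and once for each path, always as the same number. *)
by split=> [[e [e1 e2]]|[[e e1] [_ e2]]].
Qed.
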